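(* For every integer $d\geq 4$ there exists a quantum state $\rho$ on $\mathbb{C}^d\otimes\mathbb{C}^d$ that is invariant under partial transposition on the second tensor factor, i.e. $(\mathrm{id}\otimes T)(\rho)=\rho$, and satisfies \[ \mathrm{SN}(\rho)\geq\begin{cases}\lceil (d-2)/8\rceil & \text{if } d \text{ is even},\\ \lceil (d-3)/8\rceil & \text{if } d \text{ is odd}.\end{cases} \]
   Context: $T$ denotes transposition in the computational basis. The Schmidt rank of $\ket{\psi}\in\mathbb{C}^d\otimes\mathbb{C}^d$ is the rank of $\mathrm{tr}_A\ket{\psi}\bra{\psi}$; $\mathrm{SN}(\rho)$ is the minimum over decompositions $\rho=\sum_ip_i\ket{\psi_i}\bra{\psi_i}$ into convex combinations of pure states of the maximal Schmidt rank of the $\ket{\psi_i}$. *)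

(* Defs.v *)
From HB Require Import structures.
From mathcomp Require Import all_boot all_order all_algebra.
From mathcomp Require Import boolp reals.
From mathcomp Require Import complex.
Set Implicit Arguments. Unset Strict Implicit. Unset Printing Implicit Defensive.
Import Order.TTheory GRing.Theory Num.Theory.
Local Open Scope ring_scope.

Section QInfo.
Variable R : realType.
Local Notation C := (R[i]).
Variable d : nat.

(* The computational basis vector |a>|b> of C^d (x) C^d has index
   idx a b := mxvec_index a b : 'I_(d*d); unidx is the inverse bijection. *)
Definition idx (a b : 'I_d) : 'I_(d * d) := mxvec_index a b.
Definition unidx (k : 'I_(d * d)) : 'I_d * 'I_d :=
  enum_val (cast_ord (esym (mxvec_cast d d)) k).

Definition adjmx m n (A : 'M[C]_(m, n)) : 'M[C]_(n, m) := (map_mx Num.conj A)^T.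

(* positive semidefinite (over C this includes hermiticity) *)
Definition psd n (A : 'M[C]_n) : Prop :=
  forall v : 'cV[C]_n, 0 <= (adjmx v *m A *m v) 0 0.

Definition is_state (rho : 'M[C]_(d * d)) : Prop := psd rho /\ \tr rho = 1.

Definition ptransB (X : 'M[C]_(d * d)) : 'M[C]_(d * d) :=
  \matrix_(i, j) X (idx (unidx i).1 (unidx j).2) (idx (unidx j).1 (unidx i).2).

Definition ptraceA (X : 'M[C]_(d * d)) : 'M[C]_d :=
  \matrix_(b, b') \sum_(a < d) X (idx a b) (idx a b').

Definition proj (psi : 'cV[C]_(d * d)) : 'M[C]_(d * d) := psi *m adjmx psi.

Definition schmidt_rank (psi : 'cV[C]_(d * d)) : nat := \rank (ptraceA (proj psi)).

Definition decomp_maxrank (rho : 'M[C]_(d * d)) (r : nat) : Prop :=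
  exists (n : nat) (p : 'I_n -> R) (psi : 'I_n -> 'cV[C]_(d * d)),
    [/\ forall i, 0 < p i,
        \sum_(i < n) p i = 1,
        forall i, (adjmx (psi i) *m psi i) 0 0 = 1,
        rho = \sum_(i < n) (p i)%:C%C *: proj (psi i)
      & (\max_(i < n) schmidt_rank (psi i))%N = r].

(* Schmidt number: minimum over decompositions of the maximal Schmidt rank
   (0 by convention if rho admits no decomposition, i.e. is not a state) *)
Definition SN (rho : 'M[C]_(d * d)) : nat :=
  match pselect (exists r, `[< decomp_maxrank rho r >]) with
  | left h => ex_minn h
  | right _ => 0%N
  end.
End QInfo.

Definition ceil_div (a b : nat) : nat := ((a + b - 1) %/ b)%N.

(* Main.v *)
(* Let n = d / 4, w_m = \sum_a |aa> in C^m (x) C^m, let F, G be the flips of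
   C^n (x) C^n and C^2 (x) C^2, and write v' for the adjoint of v. The operator
     rho0 = w_n w_n' (x) w_2 w_2' / 2 + 1 (x) (1 - w_2 w_2' / 2)
   is positive, and so is its partial transpose
     F (x) G / 2 + 1 (x) (1 - G / 2)
       = (1 + F)/2 (x) (1 + G)/2 + (1 + (1 - F)/2) (x) (1 - G)/2.
   Give the second party an extra qubit and let b = (1, i), which is orthogonal
   to its complex conjugate: then
     sigma = rho0 (x) b b' + rho0^Gamma (x) conj(b b')
   is positive and invariant under partial transposition. Contracting the qubit
   pair with w_2 and the extra qubit with b kills the second summand and the part
   1 (x) (1 - w_2 w_2' / 2) of the first, so it sends sigma to a multiple of
   w_n w_n'; hence every pure state in a decomposition of sigma is sent to a
   multiple of w_n, for some of them a nonzero one. As w_2 has Schmidt rank 2, the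
   contraction at most doubles the Schmidt rank, and n <= 2 SN(sigma). *)
Require Import Defs.
From HB Require Import structures.
From mathcomp Require Import all_boot all_order all_algebra.
From mathcomp Require Import boolp reals.
From mathcomp Require Import complex.
From mathcomp Require Import zify ring.
Import Order.TTheory GRing.Theory Num.Theory.
Local Open Scope ring_scope.
Set Implicit Arguments. Unset Strict Implicit. Unset Printing Implicit Defensive.

(** * Positive semidefinite kernels *)

Section Gram.
Variable C : numClosedFieldType.

(* Positive semidefinite kernels, through a Gram decomposition. Tensor products become
   pointwise products of pulled-back kernels. *)
Definition gram (X : Type) (K : X -> X -> C) : Prop :=
  exists (J : finType) (M : J -> X -> C),
    forall x y, K x y = \sum_j M j x * (M j y)^*.

Lemma gram_ext X (K L : X -> X -> C) : (forall x y, K x y = L x y) -> gram L -> gram K.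
Proof. by move=> e [J [M h]]; exists J, M => x y; rewrite e h. Qed.

Lemma gram_pull X Y (f : Y -> X) (K : X -> X -> C) :
  gram K -> gram (fun x y => K (f x) (f y)).
Proof. by move=> [J [M h]]; exists J, (fun j x => M j (f x)) => x y; exact: h. Qed.

Lemma gram_add X (K L : X -> X -> C) :
  gram K -> gram L -> gram (fun x y => K x y + L x y).
Proof.
move=> [J [M h]] [J' [M' h']].
exists (J + J')%type, (fun j x => match j with inl j => M j x | inr j => M' j x end).
by move=> x y; rewrite h h' big_sumType.
Qed.

(** Schur product theorem: products of Gram vectors, indexed by pairs, factor the pointwise
    product. *)
Lemma gram_mul X (K L : X -> X -> C) :
  gram K -> gram L -> gram (fun x y => K x y * L x y).
Proof.
move=> [J [M h]] [J' [M' h']].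
exists (J * J')%type, (fun j x => M j.1 x * M' j.2 x).
move=> x y; rewrite h h' big_distrlr pair_big /=; apply: eq_bigr => j _.
by rewrite rmorphM /= mulrACA.
Qed.

Lemma gram_rank1 X (f : X -> C) : gram (fun x y => f x * (f y)^*).
Proof. by exists unit, (fun _ => f) => x y; rewrite big_const card_unit /= addr0. Qed.

Lemma gram_scale X (c : C) (K : X -> X -> C) :
  0 <= c -> gram K -> gram (fun x y => c * K x y).
Proof.
move=> c0 hK; apply: (gram_ext _ (gram_mul (gram_rank1 (fun=> sqrtC c)) hK)) => x y.
by rewrite geC0_conj ?sqrtC_ge0 // -expr2 sqrtCK.
Qed.

Lemma gram_delta (X : finType) : gram (fun x y : X => (x == y)%:R).
Proof.
exists X, (fun j x => (j == x)%:R) => x y.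
rewrite (bigD1 x) //= eqxx mul1r big1 ?addr0 ?conjC_nat // => j /negPf jx.
by rewrite jx mul0r.
Qed.

Definition swap_kernel (X : finType) (x y : X * X) : C :=
  (x.1 == y.2)%:R * (x.2 == y.1)%:R.

(* (1 + e F)/2, with F the flip and e = 1 or -1, is an orthogonal projection. *)
Lemma gram_swap (X : finType) (e : C) : e ^+ 2 = 1 -> e \is Num.real ->
  gram (fun x y : X * X => ((x == y)%:R + e * swap_kernel x y) / 2%:R).
Proof.
move=> e2 er; rewrite /swap_kernel.
exists (X * X)%type, (fun j x => ((j == x)%:R + e * (j == (x.2, x.1))%:R) / 2%:R).
move=> x y; set D := (X in (_ + e * X) / _ = _).
have D1 : D = (x == (y.2, y.1))%:R.
  by rewrite /D -natrM mulnb -xpair_eqE; case: x {D}.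
have key (u v : X * X) : \sum_j ((j == u)%:R * (j == v)%:R) = (u == v)%:R :> C.
  rewrite (bigD1 u) //= eqxx mul1r big1 ?addr0 // => j /negPf ju.
  by rewrite ju mul0r.
have inj (u v : X * X) : ((u.2, u.1) == (v.2, v.1)) = (u == v).
  by case: u v => [u1 u2] [v1 v2] /=; rewrite !xpair_eqE andbC.
have tr : ((x.2, x.1) == y) = (x == (y.2, y.1)).
  by case: (x) (y) => [u1 u2] [v1 v2] /=; rewrite !xpair_eqE andbC.
(* Expansion of the square of (1 + e F)/2; [e ^+ 2 = 1] merges the outer terms. *)
transitivity (\sum_j (((j == x)%:R * (j == y)%:R) / 4%:R
   + e / 4%:R * ((j == x)%:R * (j == (y.2, y.1))%:R)
   + e / 4%:R * ((j == (x.2, x.1))%:R * (j == y)%:R)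
   + e ^+ 2 / 4%:R * ((j == (x.2, x.1))%:R * (j == (y.2, y.1))%:R))).
  rewrite !big_split /= -mulr_suml -!mulr_sumr !key inj tr D1 e2.
  by field.
apply: eq_bigr => j _; rewrite fmorph_div rmorphD rmorphM /= !conjC_nat (CrealP er).
by field.
Qed.

End Gram.

(** * The unnormalised state [sigma] *)

Section State.
Variables (C : numClosedFieldType) (n : nat).
Local Notation S := ('I_n * bool * bool)%type.
Local Notation P := (S * S)%type.

(** The argument order selects the operator: [delta2 i j i' j'] is the identity, [delta2 i i' j j']
    is w_n w_n'. Exchanging [j] and [j'] in the latter gives the flip. *)
Definition delta2 (T : eqType) (a b a' b' : T) : C := (a == a')%:R * (b == b')%:R.

Definition rho0 (i : 'I_n) (k : bool) j l i' k' j' l' : C :=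
  delta2 i i' j j' * delta2 k k' l l' / 2%:R
  + delta2 i j i' j' * (delta2 k l k' l' - delta2 k k' l l' / 2%:R).

Definition bvec (s : bool) : C := if s then 'i else 1.

(* An element of [S] indexes C^n (x) C^2 (x) C^2. Both parties use [S], but the last
   qubit of the first party is a dummy: it only makes the two local dimensions equal,
   and [sigma] ignores it. *)
Definition sigma (x y : P) : C :=
  let: ((i, k, _), (j, l, s)) := x in
  let: ((i', k', _), (j', l', s')) := y in
  rho0 i k j l i' k' j' l' * (bvec s * (bvec s')^*)
  + rho0 i k j' l' i' k' j l * (bvec s' * (bvec s)^*).


(** Partial transposition exchanges the two summands. *)
Lemma sigma_swap (a b a' b' : S) : sigma (a, b') (a', b) = sigma (a, b) (a', b').
Proof. by case: a b a' b' => [[i k] t] [[j l] s] [[i' k'] t'] [[j' l'] s'] /=; rewrite addrC. Qed.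

Lemma gram_rho0 : gram (fun x y : ('I_n * bool) * ('I_n * bool) =>
  rho0 x.1.1 x.1.2 x.2.1 x.2.2 y.1.1 y.1.2 y.2.1 y.2.2).
Proof.
pose eps (k : bool) : C := if k then 1 else -1.
have h2 : 0 <= 2%:R^-1 :> C by rewrite invr_ge0 ler0n.
have g1 := gram_scale h2 (gram_rank1
  (fun x : ('I_n * bool) * ('I_n * bool) => (x.1.1 == x.2.1)%:R * (x.1.2 == x.2.2)%:R : C)).
have g2 := gram_pull (fun x : ('I_n * bool) * ('I_n * bool) => (x.1.1, x.2.1))
  (gram_delta C ('I_n * 'I_n)%type).
(* 1 - w_2 w_2' / 2 splits into the projection on the span of |01>, |10> ([g3]) and the one on |11>
   - |00> ([g4]). *)
have g3 := gram_mul (gram_pull (fun x : ('I_n * bool) * ('I_n * bool) => (x.1.2, x.2.2))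
  (gram_delta C (bool * bool)%type)) (gram_rank1
  (fun x : ('I_n * bool) * ('I_n * bool) => (x.1.2 != x.2.2)%:R : C)).
have g4 := gram_scale h2 (gram_rank1
  (fun x : ('I_n * bool) * ('I_n * bool) => (x.1.2 == x.2.2)%:R * eps x.1.2 : C)).
apply: (gram_ext _ (gram_add g1 (gram_mul g2 (gram_add g3 g4)))).
move=> [[i k] [j l]] [[i' k'] [j' l']] /=.
rewrite /rho0 /delta2 !rmorphM /= !conjC_nat !xpair_eqE -!mulnb !natrM.
congr (_ + _); first by ring.
congr (_ * _).
by case: k l k' l' => [] [] [] [] /=; rewrite ?rmorphN ?rmorph1 ?eqxx /=; field.
Qed.

Lemma gram_rho0_ptrans : gram (fun x y : ('I_n * bool) * ('I_n * bool) =>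
  rho0 x.1.1 x.1.2 y.2.1 y.2.2 y.1.1 y.1.2 x.2.1 x.2.2).
Proof.
pose f1 (x : ('I_n * bool) * ('I_n * bool)) := (x.1.1, x.2.1).
pose f2 (x : ('I_n * bool) * ('I_n * bool)) := (x.1.2, x.2.2).
have r1 : (1 : C) \is Num.real by rewrite rpred1.
have rN1 : (- 1 : C) \is Num.real by rewrite rpredN rpred1.
have e1 : (1 : C) ^+ 2 = 1 by rewrite expr1n.
have eN1 : (- 1 : C) ^+ 2 = 1 by rewrite sqrrN expr1n.
have s1 := gram_pull f1 (gram_swap 'I_n e1 r1).
have a1 := gram_pull f1 (gram_add (gram_delta C ('I_n * 'I_n)%type) (gram_swap 'I_n eN1 rN1)).
have s2 := gram_pull f2 (gram_swap bool e1 r1).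
have a2 := gram_pull f2 (gram_swap bool eN1 rN1).
apply: (gram_ext _ (gram_add (gram_mul s1 s2) (gram_mul a1 a2))).
move=> [[i k] [j l]] [[i' k'] [j' l']] /=.
rewrite /rho0 /delta2 /swap_kernel /= !xpair_eqE -!mulnb !natrM.
rewrite (eq_sym i' j) (eq_sym j' j) (eq_sym k' l) (eq_sym l' l).
by field.
Qed.

Lemma gram_sigma : gram (@sigma).
Proof.
pose f (x : P) := ((x.1.1.1, x.1.1.2), (x.2.1.1, x.2.1.2)).
have g1 := gram_mul (gram_pull f gram_rho0) (gram_rank1 (fun x : P => bvec x.2.2)).
have g2 := gram_mul (gram_pull f gram_rho0_ptrans) (gram_rank1 (fun x : P => (bvec x.2.2)^*)).
apply: (gram_ext _ (gram_add g1 g2)).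
move=> [[[i k] t] [[j l] s]] [[[i' k'] t'] [[j' l'] s']] /=.
by rewrite conjCK [_^* * bvec s']mulrC.
Qed.

(** The constant is 8 = (2 * 2 / 2) * (2 * 2), since w_2 and b both have squared norm 2. The second
    summand vanishes because 1 + 'i ^+ 2 = 0. *)
Lemma sigma_contract (i j i' j' : 'I_n) :
  \sum_(t : bool * bool) \sum_(t' : bool * bool)
    (bvec t.2)^* * bvec t'.2 *
      sigma ((i, t.1, false), (j, t.1, t.2)) ((i', t'.1, false), (j', t'.1, t'.2))
  = 8%:R * ((i == j)%:R * (i' == j')%:R).
Proof.
rewrite (eq_bigr (fun t : bool * bool => \sum_k' \sum_s'
    (bvec t.2)^* * bvec s' *
      sigma ((i, t.1, false), (j, t.1, t.2)) ((i', k', false), (j', k', s')))); last first.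
  by move=> t _; rewrite pair_big /=; apply: eq_bigr => -[].
rewrite -(pair_big xpredT xpredT (fun k s => \sum_k' \sum_s'
    (bvec s)^* * bvec s' *
      sigma ((i, k, false), (j, k, s)) ((i', k', false), (j', k', s')))) /=.
rewrite !big_bool /= /rho0 /delta2 /= !rmorph1 !conjCi.
have ii : 'i * 'i = -1 :> C by rewrite -expr2 sqrCi.
by field: ii.
Qed.

End State.

(** * Schmidt rank and pure-state decompositions *)

Section Schmidt.
Variable R : realType.
Local Notation C := (R[i]).

Lemma adjmx_mul m n p (A : 'M[C]_(m, n)) (B : 'M[C]_(n, p)) :
  adjmx (A *m B) = adjmx B *m adjmx A.
Proof. by rewrite /adjmx map_mxM trmx_mul. Qed.

Lemma adjmx_scale m n (c : C) (A : 'M[C]_(m, n)) : adjmx (c *: A) = c^* *: adjmx A.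
Proof. by apply/matrixP => i j; rewrite !mxE rmorphM. Qed.

Lemma adjmxK m n : cancel (@adjmx R m n) (@adjmx R n m).
Proof. by move=> A; apply/matrixP => i j; rewrite !mxE conjCK. Qed.

Lemma adjmx_mulE n (v : 'cV[C]_n) : (adjmx v *m v) 0 0 = \sum_x v x 0 * (v x 0)^*.
Proof. by rewrite mxE; apply: eq_bigr => x _; rewrite !mxE mulrC. Qed.

Lemma sum_mul_conj_eq0 n (v : 'I_n -> C) : \sum_x v x * (v x)^* = 0 -> forall x, v x = 0.
Proof.
move=> /eqP; rewrite psumr_eq0 => [/allP h x|x _]; last exact: mul_conjC_ge0.
by have := h x (mem_index_enum x); rewrite mul_conjC_eq0 => /eqP.
Qed.

(** If u A A' = 0 then u A has norm 0, so the left kernels agree. *)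
Lemma mxrank_mul_adj m n (A : 'M[C]_(m, n)) : (\rank A <= \rank (A *m adjmx A))%N.
Proof.
have h : (kermx (A *m adjmx A) <= kermx A)%MS.
  apply/sub_kermxP/row_matrixP => i; rewrite row_mul row0.
  set u := row i _; have u0 : u *m (A *m adjmx A) = 0.
    by rewrite -row_mul mulmx_ker row0.
  have : (u *m A) *m adjmx (u *m A) = 0.
    by rewrite adjmx_mul mulmxA -(mulmxA u) u0 mul0mx.
  move/matrixP/(_ 0 0); rewrite !mxE => e.
  apply/rowP => x; rewrite [RHS]mxE; move: x; apply: sum_mul_conj_eq0.
  by rewrite -[RHS]e; apply: eq_bigr => x _; rewrite !mxE.
have := mxrankS h; rewrite !mxrank_ker.
by have := rank_leq_row A; have := rank_leq_row (A *m adjmx A); lia.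
Qed.

Variable d : nat.

Lemma idxK (a b : 'I_d) : unidx (idx a b) = (a, b).
Proof. by rewrite /unidx /idx /mxvec_index cast_ordK enum_rankK. Qed.

Definition coefmx (psi : 'cV[C]_(d * d)) : 'M[C]_d := \matrix_(a, b) psi (idx a b) 0.

(** With B the transpose of [coefmx psi], the reduced operator is B B'. *)
Lemma rank_coefmx psi : (\rank (coefmx psi) <= schmidt_rank psi)%N.
Proof.
rewrite -mxrank_tr; apply: leq_trans (mxrank_mul_adj _) _.
rewrite /schmidt_rank; apply: eq_leq; congr (\rank _).
apply/matrixP => b b'; rewrite !mxE; apply: eq_bigr => a _.
by rewrite !mxE big_ord1 !mxE.
Qed.

Lemma psd_sum_proj (J : finType) (w : J -> 'cV[C]_(d * d)) : psd (\sum_j proj (w j)).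
Proof.
move=> v; rewrite mulmx_sumr mulmx_suml summxE; apply: sumr_ge0 => j _.
rewrite /proj mulmxA -mulmxA -[v in X in _ *m X]adjmxK -adjmx_mul.
by rewrite mxE big_ord1 !mxE; exact: mul_conjC_ge0.
Qed.

(** Squared norms serve as weights of the normalised vectors; zero vectors are dropped, as weights
    must be positive. *)
Lemma sum_proj_decomp (J : finType) (w : J -> 'cV[C]_(d * d)) :
  \tr (\sum_j proj (w j)) = 1 -> exists r, decomp_maxrank (\sum_j proj (w j)) r.
Proof.
pose N j := (adjmx (w j) *m w j) 0 0.
pose q j : R := complex.Re (N j).
have N0 j : 0 <= N j.
  by rewrite /N adjmx_mulE; apply: sumr_ge0 => x _; exact: mul_conjC_ge0.
have Nq j : (q j)%:C%C = N j by rewrite /q RRe_real // ger0_real.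
have q0 j : 0 <= q j by rewrite -ler0c Nq.
pose A := [pred j | 0 < q j].
have w0 j : ~~ A j -> w j = 0.
  rewrite inE -leNgt => h; have {}h : q j = 0 by apply/eqP; rewrite eq_le h q0.
  apply/colP => x; rewrite [RHS]mxE; move: x; apply: sum_mul_conj_eq0.
  by rewrite -adjmx_mulE -/(N j) -Nq h.
have sumA (T : zmodType) (F : J -> T) : (forall j, ~~ A j -> F j = 0) ->
    \sum_j F j = \sum_(i < #|A|) F (enum_val i).
  move=> F0; rewrite -big_enum_val.
  rewrite [RHS]big_mkcond /=; apply: eq_bigr => j _.
  by case: ifPn => // /F0.
move=> tr1.
eexists; exists #|A|, (fun i => q (enum_val i)),
  (fun i => (sqrtC (N (enum_val i)))^-1 *: w (enum_val i)); split.
- by move=> i; exact: (enum_valP i).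
- rewrite -sumA => [|j]; last first.
    by rewrite inE -leNgt => h; apply/eqP; rewrite eq_le h q0.
  apply: (@complexI R); rewrite rmorph_sum rmorph1 -[RHS]tr1 raddf_sum /=.
  by apply: eq_bigr => j _; rewrite Nq /proj mxtrace_mulC trace_mx11.
- move=> i; have := enum_valP i; rewrite inE => qi.
  have Ni : N (enum_val i) != 0 by rewrite -Nq gt_eqF // ltcR.
  have s0 : 0 <= (sqrtC (N (enum_val i)))^-1 by rewrite invr_ge0 sqrtC_ge0.
  rewrite adjmx_scale -scalemxAl -scalemxAr scalerA mxE -/(N _).
  by rewrite geC0_conj // -expr2 exprVn sqrtCK mulVf.
- rewrite (sumA _ (fun j => proj (w j))) => [|j /w0 ->]; last by rewrite /proj mul0mx.
  apply: eq_bigr => i _; have := enum_valP i; rewrite inE => qi.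
  have Ni : N (enum_val i) != 0 by rewrite -Nq gt_eqF // ltcR.
  have s0 : 0 <= (sqrtC (N (enum_val i)))^-1 by rewrite invr_ge0 sqrtC_ge0.
  rewrite /proj adjmx_scale -scalemxAl -scalemxAr !scalerA Nq.
  by rewrite geC0_conj // -mulrA -expr2 exprVn sqrtCK mulfV // scale1r.
- by [].
Qed.

Lemma gram_sum_proj (K : 'I_(d * d) -> 'I_(d * d) -> C) : gram K ->
  exists (J : finType) (w : J -> 'cV[C]_(d * d)), \matrix_(x, y) K x y = \sum_j proj (w j).
Proof.
move=> [J [M h]]; exists J, (fun j => \col_x M j x); apply/matrixP => x y.
rewrite summxE mxE h; apply: eq_bigr => j _.
by rewrite mxE big_ord1 !mxE.
Qed.

(** One decomposition excludes the default value 0, so the minimum is attained. *)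
Lemma SN_decomp (rho : 'M[C]_(d * d)) r : decomp_maxrank rho r -> decomp_maxrank rho (SN rho).
Proof.
move=> h; rewrite /SN; case: pselect => [e|]; last first.
  by case; exists r; apply/asboolP.
by case: ex_minnP => m /asboolP.
Qed.

(** * Contraction and the Schmidt number bound *)

Section Filter.
Variable n : nat.
Local Notation S := ('I_n * bool * bool)%type.
Variable e : S -> 'I_d.

(* Contraction of the qubit pair with w_2 and of the last qubit with b. *)
Definition filt (psi : 'cV[C]_(d * d)) : 'M[C]_n :=
  \matrix_(i, j) \sum_(t : bool * bool)
    (bvec C t.2)^* * psi (idx (e (i, t.1, false)) (e (j, t.1, t.2))) 0.

(** Each value [k] of the contracted qubit contributes a matrix [X k] obtained from [coefmx psi] by
    multiplication and row selection. *)
Lemma rank_filt psi : (\rank (filt psi) <= 2 * schmidt_rank psi)%N.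
Proof.
pose G k : 'M[C]_(d, n) :=
  \sum_s (bvec C s)^* *: colsub (fun j => e (j, k, s)) 1%:M.
pose X k := rowsub (fun i => e (i, k, false)) (coefmx psi *m G k).
have rX k : (\rank (X k) <= schmidt_rank psi)%N.
  apply: leq_trans (rank_coefmx psi); apply: leq_trans (mxrankS (rowsub_sub _ _)) _.
  exact: mxrankM_maxl.
have -> : filt psi = X true + X false.
  apply/matrixP => i j; rewrite !mxE.
  rewrite -(pair_big xpredT xpredT (fun k s =>
    (bvec C s)^* * psi (idx (e (i, k, false)) (e (j, k, s))) 0)) big_bool /=.
  have XE k : (coefmx psi *m G k) (e (i, k, false)) j =
      \sum_s (bvec C s)^* * psi (idx (e (i, k, false)) (e (j, k, s))) 0.
    rewrite /G mulmx_sumr summxE; apply: eq_bigr => s _.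
    by rewrite -scalemxAr mulmx_colsub mulmx1 !mxE.
  by congr (_ + _); rewrite -XE mxE.
by apply: leq_trans (mxrank_add _ _) _; rewrite mul2n -addnn leq_add.
Qed.

Lemma filt_sum m (p : 'I_m -> R) psi rho : rho = \sum_(q < m) (p q)%:C%C *: proj (psi q) ->
  forall i j i' j',
  \sum_(q < m) (p q)%:C%C * (filt (psi q) i j * (filt (psi q) i' j')^*) =
  \sum_(t : bool * bool) \sum_(t' : bool * bool)
    (bvec C t.2)^* * bvec C t'.2 *
    rho (idx (e (i, t.1, false)) (e (j, t.1, t.2)))
        (idx (e (i', t'.1, false)) (e (j', t'.1, t'.2))).
Proof.
move=> -> i j i' j'.
under [RHS]eq_bigr => t _ do
  (under eq_bigr => t' _ do rewrite summxE mulr_sumr; rewrite exchange_big /=).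
rewrite [RHS]exchange_big /=; apply: eq_bigr => q _.
rewrite !mxE rmorph_sum /= big_distrlr /= mulr_sumr; apply: eq_bigr => t _.
rewrite mulr_sumr; apply: eq_bigr => t' _.
by rewrite rmorphM /= conjCK !mxE big_ord1 !mxE; ring.
Qed.

Lemma filt_rank_decomp (rho : 'M[C]_(d * d)) r (c : C) : (0 < n)%N -> 0 < c ->
  (forall i j i' j',
    \sum_(t : bool * bool) \sum_(t' : bool * bool)
      (bvec C t.2)^* * bvec C t'.2 *
      rho (idx (e (i, t.1, false)) (e (j, t.1, t.2)))
          (idx (e (i', t'.1, false)) (e (j', t'.1, t'.2))) =
    c * ((i == j)%:R * (i' == j')%:R)) ->
  decomp_maxrank rho r -> (n <= 2 * r)%N.
Proof.
move=> n0 c0 hc [m [p [psi [p0 _ _ rhoE <-]]]].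
have F := filt_sum rhoE.
pose i0 := Ordinal n0.
have pC q : 0 < (p q)%:C%C :> C by rewrite ltcR.
have zero (f : 'I_m -> C) : \sum_q (p q)%:C%C * (f q * (f q)^*) = 0 -> forall q, f q = 0.
  move=> /eqP; rewrite psumr_eq0 => [/allP h q|q _]; last first.
    by rewrite mulr_ge0 ?mul_conjC_ge0 // ltW.
  have := h q (mem_index_enum q); rewrite mulf_eq0 gt_eqF //= mul_conjC_eq0.
  by move/eqP.
(* A positively weighted sum of squared moduli vanishes, hence so does each term; [diag] applies
   this to differences of diagonal entries. *)
have off i j : i != j -> forall q, filt (psi q) i j = 0.
  by move=> /negPf ij; apply: zero; rewrite F hc ij mul0r mulr0.
have diag i q : filt (psi q) i i = filt (psi q) i0 i0.
  apply/eqP; rewrite -subr_eq0; apply/eqP; move: q; apply: zero.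
  under eq_bigr => q _ do rewrite rmorphB mulrBl !mulrBr.
  by rewrite !sumrB !F !hc !eqxx; ring.
have [q hq] : exists q, filt (psi q) i0 i0 != 0.
  apply/existsP; apply: contraT; rewrite negb_exists => /forallP h.
  have := F i0 i0 i0 i0; rewrite hc !eqxx !mulr1 big1 => [|q _].
    by move=> c1; rewrite c1 ltxx in c0.
  by move: (h q); rewrite negbK => /eqP ->; rewrite mul0r mulr0.
(* A nonzero multiple of w_n is a nonzero scalar matrix, of rank [n]. *)
have E : filt (psi q) = (filt (psi q) i0 i0)%:M.
  apply/matrixP => i j; rewrite [RHS]mxE; have [<-|ij] := eqVneq i j.
    by rewrite diag.
  by rewrite off.
have := rank_filt (psi q).
rewrite {1}E -scalemx1 mxrank_scale_nz // mxrank1 => h.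
by apply: leq_trans h _; rewrite leq_mul2l /=; exact: (leq_bigmax q).
Qed.

End Filter.
End Schmidt.

(** * Transfer to dimension [d] *)

Lemma ordinal_surj (T : finType) d : (0 < #|T| <= d)%N ->
  exists (u : 'I_d -> T) (e : T -> 'I_d), cancel e u.
Proof.
move=> /andP[T0 Td]; pose x0 := enum_val (Ordinal T0).
(* Indices beyond the size of [T] fall on the default [x0]. *)
exists (fun i => nth x0 (enum T) i), (fun x => widen_ord Td (enum_rank x)) => x /=.
by rewrite -enum_val_nth enum_rankK.
Qed.

Theorem theorem10 (R : realType) (d : nat) :
  (4 <= d)%N ->
  exists rho : 'M[R[i]]_(d * d),
    [/\ is_state rho,
        ptransB rho = rho
      & ((if odd d then ceil_div (d - 3) 8 else ceil_div (d - 2) 8) <= SN rho)%N].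
Proof.
move=> d4; set n := (d %/ 4)%N.
have n0 : (0 < n)%N by rewrite /n; lia.
pose S := ('I_n * bool * bool)%type.
have [|u [e ue]] := @ordinal_surj S d.
  by rewrite !card_prod card_ord card_bool /n; lia.
pose f (x : 'I_(d * d)) := (u (unidx x).1, u (unidx x).2).
have fE a b : f (idx a b) = (u a, u b) by rewrite /f idxK.
pose K x y := sigma R[i] (f x) (f y).
have gK : gram K := gram_pull f (gram_sigma _ n).
have K0 x : 0 <= K x x.
  by have [J [M ->]] := gK; apply: sumr_ge0 => j _; exact: mul_conjC_ge0.
pose T := \sum_x K x x.
have T0 : 0 < T.
  pose i0 : 'I_n := Ordinal n0.
  (* Unequal qubits kill the w_2 terms, so this diagonal entry is 1 + 1. *)
  pose x := idx (e (i0, true, true)) (e (i0, false, true)).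
  rewrite /T (bigD1 x) //=; apply: ltr_pwDl; last exact: sumr_ge0.
  rewrite /K /x fE !ue /sigma /rho0 /delta2 /= ?eqxx /= -normCK normCi.
  by rewrite !(mulr0, mul0r, mulr1, mul1r, expr1n, subr0, add0r) addr_gt0 ?ltr01.
have gK' : gram (fun x y => T^-1 * K x y).
  by apply: gram_scale gK; rewrite invr_ge0 ltW.
pose rho : 'M[R[i]]_(d * d) := \matrix_(x, y) (T^-1 * K x y).
have tr1 : \tr rho = 1.
  rewrite /mxtrace; under eq_bigr => x _ do rewrite mxE.
  by rewrite -mulr_sumr mulVf // gt_eqF.
have [J [w rhoE]] := gram_sum_proj gK'.
exists rho; split.
- by split=> //; rewrite /rho rhoE; exact: psd_sum_proj.
- by apply/matrixP => x y; rewrite !mxE /K !fE sigma_swap.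
- have [r hr] : exists r, decomp_maxrank rho r.
    by rewrite /rho rhoE; apply: sum_proj_decomp; rewrite -rhoE.
  have c0 : 0 < T^-1 * 8%:R by rewrite mulr_gt0 ?invr_gt0 ?ltr0n.
  have : (n <= 2 * SN rho)%N.
    apply: (filt_rank_decomp (e := e) n0 c0 _ (SN_decomp hr)) => i j i' j'.
    rewrite -mulrA -sigma_contract mulr_sumr.
    apply: eq_bigr => t _; rewrite mulr_sumr; apply: eq_bigr => t' _.
    by rewrite mxE /K !fE !ue mulrCA.
  (* For even [d], d - 2 <= 4 n; for odd [d], d - 3 <= 4 n; and 4 n <= 8 [SN rho]. *)
  by rewrite /ceil_div /n; case: ifP; lia.
Qed.
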